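(* Let $H$ be a semisimple quasitriangular Hopf algebra over $\mathbb C$. Then the commutator matrix $A$ of $H$ has $1$ as an eigenvalue with corresponding $1$-dimensional eigenspace. All other eigenvalues $c$ of $A$ satisfy $|c|<1$.
   Context: Notation: $\varepsilon$ is the counit of $H$, $s$ is the antipode of $H^*$, $\Lambda$ is the idempotent integral of $H$, $\langle\,,\rangle$ is the evaluation pairing. $\chi_0=\varepsilon,\chi_1,\dots,\chi_{n-1}\in H^*$ are the irreducible characters of $H$ and $d_i=\langle\chi_i,1\rangle$ their degrees. The commutator matrix of $H$ is $A=(A_{ij})_{0\le i,j\le n-1}$ with $$A_{ij}=\frac{\langle\chi_is(\chi_i)s(\chi_j),\Lambda\rangle}{d_j}$$ (products taken in $H^*$). It is the matrix of the operator $T$ on the center $Z(H)$, $T(z)=\{z,\Lambda\}=\sum z_1\Lambda_1S(z_2)S(\Lambda_2)$, with respect to the basis $\{E_i/d_i^2\}$, where $E_i$ is the central primitive idempotent associated with $\chi_i$ and $S$ is the antipode of $H$. *)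

(* Defs.v *)
From HB Require Import structures.
From mathcomp Require Import all_boot all_order all_algebra falgebra.
From mathcomp Require Import reals complex.

Set Implicit Arguments.
Unset Strict Implicit.
Unset Printing Implicit Defensive.

Import GRing.Theory.
Local Open Scope ring_scope.

(* Tensor products of finite-dimensional vector spaces, in coordinates with   *)
(* respect to the distinguished bases vbasis {:U} and vbasis {:V}; the        *)
(* universal property is tlift_tensor and tens_ext below.                     *)

Definition tens (F : fieldType) (U V : vectType F) : Type :=
  'M[F]_(\dim {:U}, \dim {:V}).

HB.instance Definition _ (F : fieldType) (U V : vectType F) :=
  Vector.on (tens U V).

Section Tensor.
Variables (F : fieldType) (U V : vectType F).

Definition tensor (u : U) (v : V) : tens U V :=
  \matrix_(i, j) (coord (vbasis {:U}) i u * coord (vbasis {:V}) j v).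

Definition tlift (W : lmodType F) (f : U -> V -> W) (t : tens U V) : W :=
  \sum_i \sum_j t i j *: f (vbasis {:U})`_i (vbasis {:V})`_j.

Definition bilin (W : lmodType F) (f : U -> V -> W) : Prop :=
  (forall v, linear (f^~ v)) /\ (forall u, linear (f u)).

Lemma tlift_is_linear (W : lmodType F) (f : U -> V -> W) : linear (tlift f).
Proof.
move=> a s t; rewrite /tlift scaler_sumr -big_split; apply: eq_bigr => i _ /=.
rewrite scaler_sumr -big_split; apply: eq_bigr => j _ /=.
by rewrite !mxE scalerDl scalerA.
Qed.

HB.instance Definition _ (W : lmodType F) (f : U -> V -> W) :=
  GRing.isLinear.Build F (tens U V) W *:%R (tlift f) (tlift_is_linear f).

Lemma bilin_tensor : bilin tensor.
Proof.
split=> [v a x y | u a x y]; apply/matrixP=> i j; rewrite !mxE linearP /=.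
  by rewrite mulrDl mulrA.
by rewrite mulrDr mulrCA.
Qed.

Lemma bilin_suml (W : lmodType F) (f : U -> V -> W) : bilin f ->
  forall n (a : 'I_n -> F) (x : 'I_n -> U) v,
  f (\sum_i a i *: x i) v = \sum_i a i *: f (x i) v.
Proof.
case=> lin _ n a x v.
pose g := GRing.isLinear.Build F U W *:%R (f^~ v) (lin v).
pose h : {linear U -> W} := HB.pack (f^~ v) g.
rewrite -[LHS]/(h _) linear_sum; apply: eq_bigr => i _.
by rewrite linearZ.
Qed.

Lemma bilin_sumr (W : lmodType F) (f : U -> V -> W) : bilin f ->
  forall n (a : 'I_n -> F) u (y : 'I_n -> V),
  f u (\sum_i a i *: y i) = \sum_i a i *: f u (y i).
Proof.
case=> _ lin n a u y.
pose g := GRing.isLinear.Build F V W *:%R (f u) (lin u).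
pose h : {linear V -> W} := HB.pack (f u) g.
rewrite -[LHS]/(h _) linear_sum; apply: eq_bigr => i _.
by rewrite linearZ.
Qed.

Lemma tlift_tensor (W : lmodType F) (f : U -> V -> W) : bilin f ->
  forall u v, tlift f (tensor u v) = f u v.
Proof.
move=> lf u v.
rewrite [in RHS](coord_vbasis (memvf u)) [in RHS](coord_vbasis (memvf v)).
rewrite (bilin_suml lf); apply: eq_bigr => i _.
rewrite (bilin_sumr lf) scaler_sumr; apply: eq_bigr => j _.
by rewrite mxE scalerA.
Qed.

Lemma tlift_id (t : tens U V) : t = tlift tensor t.
Proof.
have fU := basis_free (vbasisP {:U}); have fV := basis_free (vbasisP {:V}).
apply/matrixP=> i j; rewrite /tlift summxE (bigD1 i) //= summxE (bigD1 j) //=.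
rewrite !mxE !coord_free // !eqxx !mulr1 !big1 ?addr0 // => [k ki | l lj].
  rewrite summxE big1 // => l _.
  by rewrite !mxE (coord_free _ _ fU) (negbTE ki) mul0r mulr0.
by rewrite !mxE (coord_free _ _ fV) (negbTE lj) !mulr0.
Qed.

Lemma tens_ind (P : tens U V -> Prop) :
  (forall u v, P (tensor u v)) ->
  (forall a s t, P s -> P t -> P (a *: s + t)) -> forall t, P t.
Proof.
move=> Pten Plin t.
have P0 : P 0.
  by rewrite -[0](addNr (tensor 0 0)) -scaleN1r; apply: Plin.
rewrite [t]tlift_id /tlift; elim/big_rec: _ => // i s _ Ps.
have: P s by []; move: (s); elim/big_rec: _ => [x Px | j y _ IH x Px].
  by rewrite add0r.
by rewrite -addrA; apply: Plin => //; apply: IH.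
Qed.

Lemma tens_ext (W : lmodType F) (f g : {linear tens U V -> W}) :
  (forall u v, f (tensor u v) = g (tensor u v)) -> f =1 g.
Proof. by move=> fg; elim/tens_ind=> // a s t fs ft; rewrite !linearP fs ft. Qed.

Lemma tlift_param_linear (X W : lmodType F) (f : X -> U -> V -> W) s :
  (forall u v, linear (fun x => f x u v)) -> linear (fun x => tlift (f x) s).
Proof.
move=> lf a x y; rewrite /tlift scaler_sumr -big_split; apply: eq_bigr => i _.
rewrite scaler_sumr -big_split; apply: eq_bigr => j _ /=.
by rewrite lf scalerDr !scalerA mulrC.
Qed.

End Tensor.

Section TensorAlgebra.
Variables (F : fieldType) (A B : falgType F).
Implicit Types s t : tens A B.

Definition tens_mul s t : tens A B :=
  tlift (fun a b => tlift (fun c d => tensor (a * c) (b * d)) t) s.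
Definition tens_one : tens A B := tensor 1 1.

Lemma tens_mulPl t : linear (tens_mul^~ t).
Proof. by move=> a x y; rewrite /tens_mul linearP. Qed.

Lemma tens_mulPr s : linear (tens_mul s).
Proof.
by apply: tlift_param_linear => u v a x y; rewrite linearP.
Qed.

Lemma tens_mulE a b c d :
  tens_mul (tensor a b) (tensor c d) = tensor (a * c) (b * d).
Proof.
have [tl tr] := @bilin_tensor F A B.
have bil x y : bilin (fun c d => tensor (x * c) (y * d) : tens A B).
  split=> z k u w; first by rewrite mulrDr -scalerAr tl.
  by rewrite mulrDr -scalerAr tr.
rewrite /tens_mul tlift_tensor ?tlift_tensor //.
split=> z k u w.
  rewrite -[RHS](tlift_param_linear
    (f := fun x c d => tensor (x * c) (z * d))) // => c' d' l x y.
  by rewrite mulrDl -scalerAl tl.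
rewrite -[RHS](tlift_param_linear
  (f := fun x c d => tensor (z * c) (x * d))) // => c' d' l x y.
by rewrite mulrDl -scalerAl tr.
Qed.

Fact tens_mulA : associative tens_mul.
Proof.
move=> x y z; elim/tens_ind: x => [a b | k s t]; last first.
  by rewrite !tens_mulPl => -> ->.
elim/tens_ind: y => [c d | k s t]; last first.
  by rewrite tens_mulPl !tens_mulPr tens_mulPl => -> ->.
elim/tens_ind: z => [e f | k s t]; last by rewrite !tens_mulPr => -> ->.
by rewrite !tens_mulE !mulrA.
Qed.

Fact tens_mul1 : left_id tens_one tens_mul.
Proof.
elim/tens_ind=> [a b | k s t]; first by rewrite tens_mulE !mul1r.
by rewrite tens_mulPr => -> ->.
Qed.

Fact tens_mulr1 : right_id tens_one tens_mul.
Proof.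
elim/tens_ind=> [a b | k s t]; first by rewrite tens_mulE !mulr1.
by rewrite tens_mulPl => -> ->.
Qed.

Fact tens_mulDl : left_distributive tens_mul +%R.
Proof. by move=> x y z; rewrite -[x]scale1r tens_mulPl !scale1r. Qed.

Fact tens_mulDr : right_distributive tens_mul +%R.
Proof. by move=> x y z; rewrite -[y]scale1r tens_mulPr !scale1r. Qed.

Fact tens_one_neq0 : tens_one != 0.
Proof.
have coord1 (D : falgType F) : exists i, coord (vbasis {:D}) i 1 != 0.
  apply/existsP; apply: contraT => /existsPn all0.
  have /eqP[] := oner_neq0 D; rewrite (coord_vbasis (memvf (1 : D))).
  by rewrite big1 // => i _; move/negPn/eqP: (all0 i) => ->; rewrite scale0r.
have [[i ai] [j bj]] := (coord1 A, coord1 B).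
apply/eqP => /matrixP/(_ i j)/eqP.
by rewrite !mxE mulf_eq0 (negbTE ai) (negbTE bj).
Qed.

HB.instance Definition _ := GRing.Zmodule_isNzRing.Build (tens A B)
  tens_mulA tens_mul1 tens_mulr1 tens_mulDl tens_mulDr tens_one_neq0.

Fact tens_scaleAl k s t : k *: (s * t) = (k *: s) * t.
Proof.
rewrite -[RHS]/(tens_mul _ _) -[_ *: s]addr0 tens_mulPl.
by rewrite -[tens_mul 0 t]/(0 * t) mul0r addr0.
Qed.
HB.instance Definition _ :=
  GRing.Lmodule_isLalgebra.Build F (tens A B) tens_scaleAl.

Fact tens_scaleAr k s t : k *: (s * t) = s * (k *: t).
Proof.
rewrite -[RHS]/(tens_mul _ _) -[_ *: t]addr0 tens_mulPr.
by rewrite -[tens_mul s 0]/(s * 0) mulr0 addr0.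
Qed.
HB.instance Definition _ :=
  GRing.Lalgebra_isAlgebra.Build F (tens A B) tens_scaleAr.

HB.instance Definition _ := Algebra_isFalgebra.Build F (tens A B).

Lemma tensorM a b c d :
  (tensor a b : tens A B) * tensor c d = tensor (a * c) (b * d).
Proof. exact: tens_mulE. Qed.

End TensorAlgebra.

(* Hopf algebras; the triple tensor power is bracketed as H (x) (H (x) H).    *)

HB.mixin Record isHopf (F : fieldType) H of Falgebra F H := {
  comul : {lrmorphism H -> tens H H};
  counit : {lrmorphism H -> F | *%R};
  antipode : {linear H -> H};
  comulA : forall h : H,
    tlift (fun a b => tlift (fun a1 a2 => tensor a1 (tensor a2 b)) (comul a))
      (comul h) =
    tlift (fun a b => tensor a (comul b)) (comul h);
  counit_comull : forall h : H, tlift (fun a b => counit a *: b) (comul h) = h;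
  counit_comulr : forall h : H, tlift (fun a b => counit b *: a) (comul h) = h;
  antipode_comull : forall h : H,
    tlift (fun a b => antipode a * b) (comul h) = counit h *: 1;
  antipode_comulr : forall h : H,
    tlift (fun a b => a * antipode b) (comul h) = counit h *: 1
}.

#[short(type="hopfAlgType")]
HB.structure Definition HopfAlgebra (F : fieldType) :=
  { H of isHopf F H & Falgebra F H }.

Section Hopf.
Variables (F : fieldType) (H : hopfAlgType F).

Definition tswap : tens H H -> tens H H := tlift (fun a b => tensor b a).

Definition legs12 : tens H H -> tens H (tens H H) :=
  tlift (fun a b => tensor a (tensor b 1)).
Definition legs13 : tens H H -> tens H (tens H H) :=
  tlift (fun a b => tensor a (tensor 1 b)).
Definition legs23 : tens H H -> tens H (tens H H) := tensor 1.

(* R is a universal R-matrix, i.e. (H, R) is quasitriangular. *)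
Definition quasitriangular (R : tens H H) : Prop :=
  [/\ R \is a GRing.unit,
      forall h : H, tswap (comul h) = R * comul h * R^-1,
      tlift (fun a b =>
          tlift (fun a1 a2 => tensor a1 (tensor a2 b)) (comul a)) R =
        legs13 R * legs23 R
    & tlift (fun a b => tensor a (comul b)) R = legs13 R * legs12 R].

(* H is semisimple as a left module over itself. *)
Definition left_ideal (I : {vspace H}) : Prop :=
  forall h x : H, x \in I -> h * x \in I.
Definition semisimple : Prop :=
  forall I, left_ideal I ->
  exists J, [/\ left_ideal J, (I + J = fullv)%VS & (I :&: J = 0)%VS].

Definition idempotent_integral (L : H) : Prop :=
  [/\ forall h, h * L = counit h *: L, forall h, L * h = counit h *: L,
      L * L = L & L != 0].

(* Matrices act on column vectors, so that a morphism H -> 'M_n is a left     *)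
(* H-module.                                                                  *)
Definition irreducible_rep n (rho : {lrmorphism H -> 'M[F]_n.+1}) : Prop :=
  forall W : {vspace 'cV[F]_n.+1},
  (forall h w, w \in W -> rho h *m w \in W) -> W = 0%VS \/ W = fullv.

Definition dual := 'Hom(H, F^o).

Definition irreducible_character (chi : dual) : Prop :=
  exists n (rho : {lrmorphism H -> 'M[F]_n.+1}),
  irreducible_rep rho /\ forall h, chi h = \tr (rho h).

Definition irr_enum n (chi : 'I_n.+1 -> dual) : Prop :=
  [/\ injective chi,
      forall f, irreducible_character f <-> exists i, chi i = f
    & forall h, chi ord0 h = counit h].

(* The convolution product of H^*, and the antipode of H^*. *)
Definition conv (f g : dual) : dual :=
  linfun (tlift (fun a b => f a * g b) \o comul).
Definition dual_antipode (f : dual) : dual := linfun (f \o antipode).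

Lemma convE f g h : conv f g h = tlift (fun a b => f a * g b) (comul h).
Proof. by rewrite lfunE. Qed.

Lemma dual_antipodeE f h : dual_antipode f h = f (antipode h).
Proof. by rewrite lfunE. Qed.

Definition commutator_mx n (chi : 'I_n.+1 -> dual) (L : H) : 'M[F]_n.+1 :=
  \matrix_(i, j) (conv (conv (chi i) (dual_antipode (chi i)))
                    (dual_antipode (chi j)) L / chi j 1).

End Hopf.

(* Main.v *)
Require Import Defs.
From HB Require Import structures.
From mathcomp Require Import all_boot all_order all_algebra falgebra.
From mathcomp Require Import reals complex boolp mxtens.

(** Write V_i for the representation with character chi_i and d_i for its
    degree. Up to the factor 1 / d_j, the entry A_ij is the multiplicity N_ij of
    chi_j in the character chi_i s(chi_i) of End(V_i): it is the trace of the
    idempotent by which the integral acts on Hom(V_j, End(V_i)). Hence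

    - N_ij is a natural number (casimir_form_conv_nat);
    - N_i0 > 0, because the identity of V_i is an invariant in End(V_i)
      (casimir_form_conv_trivial_gt0);
    - the sum of N_ij d_j over j is d_i^2 (casimir_form_conv_degree_sum), so the
      positive vector (d_j^2) is fixed by A.

    Rescaling by d_j^2 thus makes A a stochastic matrix, from each of whose
    states the state 0 is reached in one step with positive probability. Since
    the last two properties for i = 0 force N_0j = 0 for j != 0, the state 0 is
    absorbing. Such a matrix strictly contracts the vectors that vanish at 0, in
    a weighted maximum norm (absorbing_contraction), and an eigenvector for
    c != 1 vanishes at 0, as does one for c = 1 after subtracting a multiple of
    the fixed vector.

    The algebra needed for the degree sum rests on the Casimir element
    T = L_1 (x) S(L_2), for which h T = T h (integral_casimir). Averaging a
    matrix over T gives an intertwiner, so Schur's lemma yields the orthogonality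
    relations, and these identify the coefficients of the regular character:
    it is the sum of d_j chi_j (regular_character_sum). On the other hand,
    pairing a trace function f with the regular character through T gives f(1)
    (casimir_form_regular), and f = chi_i s(chi_i) has f(1) = d_i^2. *)

Set Implicit Arguments.
Unset Strict Implicit.
Unset Printing Implicit Defensive.

Import Order.TTheory GRing.Theory Num.Theory.
Local Open Scope ring_scope.

(** * Nonnegative matrices with an absorbing state *)

Section AbsorbingMatrix.
Variables (C : numFieldType) (n : nat) (A : 'M[C]_n.+1) (w : 'rV[C]_n.+1).
Hypothesis w_gt0 : forall i, 0 < w 0 i.
Hypothesis A_ge0 : forall i j, 0 <= A i j.
Hypothesis wA : w *m A^T = w.
Hypothesis A_col0 : forall i, 0 < A i 0.
Hypothesis A_row0 : forall j, j != 0 -> A 0 j = 0.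

(** At an index i where |v i| / w i is maximal, the coordinate 0 of v contributes
    nothing to row i, while it carries the positive part A i 0 * w 0 of the
    weight w i; hence |c| |v i| < |v i|. *)
Lemma absorbing_contraction c (v : 'rV[C]_n.+1) :
  v *m A^T = c *: v -> v 0 0 = 0 -> v != 0 -> `|c| < 1.
Proof.
move=> vA v0 vN0; pose M i := `|v 0 i| / w 0 i.
have Mreal : {in predT, forall i, M i \is Num.real}.
  by move=> i _; rewrite ger0_real // divr_ge0 // ltW.
case: (real_arg_maxP (i0 := 0) (P := predT) isT Mreal) => i _ maxi.
have vle j : `|v 0 j| <= M i * w 0 j.
  by rewrite -ler_pdivrMr //; exact: (maxi j isT).
have Mi_gt0 : 0 < M i.
  have /rV0Pn[j vj] := vN0.
  by apply: lt_le_trans (maxi j isT); rewrite divr_gt0 ?normr_gt0.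
have viE : `|v 0 i| = M i * w 0 i by rewrite divfK // gt_eqF.
have vi_gt0 : 0 < `|v 0 i| by rewrite viE mulr_gt0.
have rowE (u : 'rV_n.+1) k : (u *m A^T) 0 k = \sum_j u 0 j * A k j.
  by rewrite mxE; apply: eq_bigr => j _; rewrite mxE.
have wE : w 0 i = \sum_j w 0 j * A i j by rewrite -rowE wA.
suff : `|c| * `|v 0 i| < `|v 0 i| by rewrite gtr_pMl.
rewrite -normrM; have -> : c * v 0 i = \sum_j v 0 j * A i j.
  by rewrite -rowE vA mxE.
apply: le_lt_trans (ler_norm_sum _ _ _) _.
rewrite viE wE mulr_sumr (bigD1 0) //= [ltRHS](bigD1 0) //=.
rewrite v0 mul0r normr0; apply: ltr_leD.
  by apply: mulr_gt0 => //; apply: mulr_gt0.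
apply: ler_sum => j _; rewrite normrM (ger0_norm (A_ge0 i j)) mulrA.
by rewrite ler_wpM2r.
Qed.

(** Row 0 of A is that of the identity, so an eigenvector for c != 1 vanishes at
    0; for c = 1 it does so after subtracting a multiple of w. *)
Lemma absorbing_spectrum :
  [/\ eigenvalue A^T 1, \rank (eigenspace A^T 1) = 1%N
    & forall c, eigenvalue A^T c -> c != 1 -> `|c| < 1].
Proof.
have w0 : w 0 0 != 0 by rewrite gt_eqF.
have wN0 : w != 0 by apply: contraNneq w0 => ->; rewrite mxE.
have w_eig : (w <= eigenspace A^T 1)%MS.
  by apply/eigenspaceP; rewrite wA scale1r.
have row0 (v : 'rV_n.+1) : (v *m A^T) 0 0 = v 0 0.
  have A00 : A 0 0 = 1.
    apply: (mulfI w0); rewrite mulr1 -[in RHS]wA mxE (bigD1 0) //= mxE.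
    rewrite big1 ?addr0 // => j j0.
    by rewrite mxE A_row0 // mulr0.
  rewrite mxE (bigD1 0) //= mxE A00 mulr1 big1 ?addr0 // => j j0.
  by rewrite mxE A_row0 // mulr0.
have ev1 : eigenvalue A^T 1.
  by apply/eigenvalueP; exists w => //; rewrite wA scale1r.
split=> //; last first.
  move=> c /eigenvalueP[v vA vN0] c1; apply: absorbing_contraction (vA) _ vN0.
  have /eqP := row0 v; rewrite vA mxE -subr_eq0 -{2}[v 0 0]mul1r -mulrBl.
  by rewrite mulf_eq0 subr_eq0 (negbTE c1) => /eqP.
apply/eqP; rewrite eqn_leq lt0n mxrank_eq0 andbC.
apply/andP; split; first exact: ev1.
rewrite -[1%N](_ : \rank w = 1%N); last by rewrite rank_rV wN0.
apply: mxrankS; apply/rV_subP => v /eigenspaceP; rewrite scale1r => vA.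
pose u := v - (v 0 0 / w 0 0) *: w.
have uA : u *m A^T = 1 *: u by rewrite mulmxBl -scalemxAl vA wA scale1r.
have u0 : u 0 0 = 0 by rewrite !mxE divfK // subrr.
have [/eqP|uN0] := eqVneq u 0.
  by rewrite subr_eq0 => /eqP->; apply: scalemx_sub.
by have := absorbing_contraction uA u0 uN0; rewrite normr1 ltxx.
Qed.

End AbsorbingMatrix.

(** * Calculus of the extension of bilinear maps to a tensor product *)

Lemma linearZ_of (F : fieldType) (U V : lmodType F) (f : U -> V) :
  linear f -> forall a u, f (a *: u) = a *: f u.
Proof.
move=> lf a u; pose g : {linear U -> V} :=
  HB.pack f (GRing.isLinear.Build F U V *:%R f lf).
by rewrite -[f]/(g : U -> V) linearZ.
Qed.

Section Tlift.
Variables (F : fieldType) (U V : vectType F).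

Lemma eq_tlift (W : lmodType F) (f g : U -> V -> W) t :
  f =2 g -> tlift f t = tlift g t.
Proof.
by move=> fg; apply: eq_bigr => i _; apply: eq_bigr => j _; rewrite fg.
Qed.

Lemma linear_tlift (W X : lmodType F) (g : {linear W -> X}) (f : U -> V -> W) t :
  g (tlift f t) = tlift (fun u v => g (f u v)) t.
Proof.
rewrite /tlift linear_sum; apply: eq_bigr => i _; rewrite linear_sum.
by apply: eq_bigr => j _; rewrite linearZ.
Qed.

Lemma linear_tlift_of (W X : lmodType F) (g : W -> X) (f : U -> V -> W) t :
  linear g -> g (tlift f t) = tlift (fun u v => g (f u v)) t.
Proof.
move=> lg; pose g' : {linear W -> X} :=
  HB.pack g (GRing.isLinear.Build F W X *:%R g lg).
exact: (linear_tlift g').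
Qed.

Lemma tliftZ (W : lmodType F) c (f : U -> V -> W) t :
  tlift (fun u v => c *: f u v) t = c *: tlift f t.
Proof. by rewrite linear_tlift. Qed.

Lemma tlift_sum (W : lmodType F) (I : finType) (f : I -> U -> V -> W) t :
  tlift (fun u v => \sum_i f i u v) t = \sum_i tlift (f i) t.
Proof.
rewrite /tlift [RHS]exchange_big; apply: eq_bigr => k _.
rewrite [RHS]exchange_big; apply: eq_bigr => l _.
by rewrite scaler_sumr.
Qed.

Lemma tlift_mulLR (B : algType F) x y (f : U -> V -> B) t :
  tlift (fun u v => x * f u v * y) t = x * tlift f t * y.
Proof.
apply/esym/(linear_tlift_of (g := fun z => x * z * y)).
by move=> k u v; rewrite mulrDr mulrDl -scalerAr -scalerAl.
Qed.

(** Sums over the legs of two independent coproducts commute; together with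
    sweedler_assoc below this is what computations in Sweedler notation use. *)
Lemma tlift_exchange (U' V' : vectType F) (W : lmodType F)
    (f : U -> V -> U' -> V' -> W) s t :
  tlift (fun a b => tlift (f a b) t) s =
  tlift (fun c d => tlift (fun a b => f a b c d) s) t.
Proof.
transitivity (\sum_p \sum_q (s p.1 p.2 * t q.1 q.2) *:
   f (vbasis {:U})`_p.1 (vbasis {:V})`_p.2
     (vbasis {:U'})`_q.1 (vbasis {:V'})`_q.2).
  rewrite /tlift pair_big /=; apply: eq_bigr => p _.
  rewrite pair_big /= scaler_sumr; apply: eq_bigr => q _.
  by rewrite scalerA.
rewrite exchange_big /tlift [RHS]pair_big /=; apply: eq_bigr => q _.
rewrite [in RHS]pair_big /= scaler_sumr; apply: eq_bigr => p _.
by rewrite scalerA mulrC.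
Qed.

End Tlift.

Lemma tlift_mul (F : fieldType) (A B : falgType F) (W : lmodType F)
    (f : A -> B -> W) (s t : tens A B) : bilin f ->
  tlift f (s * t) =
  tlift (fun a b => tlift (fun c d => f (a * c) (b * d)) t) s.
Proof.
move=> bf; rewrite -[s * t]/(tens_mul s t) /tens_mul linear_tlift.
apply: eq_tlift => a b; rewrite linear_tlift.
by apply: eq_tlift => c d /=; exact: tlift_tensor.
Qed.

(* Tactics that discharge the linearity side conditions of Sweedler sums. *)
Ltac lin_rw :=
  rewrite ?(linearD, linearZ, mulrDl, mulrDr, linearP) /=;
  rewrite ?(linearD, linearZ, mulrDl, mulrDr, linearP) /=;
  rewrite -?scalerAl -?scalerAr ?(linearD, linearZ, linearP) /=;
  rewrite -?scalerAl -?scalerAr.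
Ltac lin :=
  first [ by move=> ? ? ?; lin_rw
        | apply: tlift_param_linear => ? ?; lin ].

(** * The antipode and the Casimir element of an integral *)

Section HopfIdentities.
Variables (F : fieldType) (H : hopfAlgType F).
Local Notation S := (@antipode F H).
Local Notation eps := (@counit F H).
Local Notation Delta := (@comul F H).
Implicit Types h k : H.

(** Coassociativity in the form in which it is applied: a trilinear expression
    may be summed over h_1, h_2, h_3 with either bracketing. *)
Lemma sweedler_assoc (W : lmodType F) (G : H -> H -> H -> W) h :
  (forall b c, linear (fun a => G a b c)) ->
  (forall a c, linear (fun b => G a b c)) ->
  (forall a b, linear (G a b)) ->
  tlift (fun a c => tlift (fun a1 a2 => G a1 a2 c) (Delta a)) (Delta h) =
  tlift (fun a b => tlift (G a) (Delta b)) (Delta h).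
Proof.
move=> l1 l2 l3.
have bG a : bilin (G a) by [].
have bK : bilin (fun a (t : tens H H) => tlift (G a) t).
  by split=> [t | a]; [apply: tlift_param_linear | apply: linearP].
have KE a t : tlift (fun a (t : tens H H) => tlift (G a) t) (tensor a t) =
  tlift (G a) t by rewrite tlift_tensor.
transitivity (tlift (fun a (t : tens H H) => tlift (G a) t)
  (tlift (fun a b => tensor a (Delta b)) (Delta h))); last first.
  by rewrite linear_tlift; apply: eq_tlift => a b /=; rewrite KE.
rewrite -comulA linear_tlift; apply: eq_tlift => a b.
rewrite linear_tlift; apply: eq_tlift => a1 a2 /=.
by rewrite KE tlift_tensor.
Qed.

Lemma counit_left (W : lmodType F) (f : H -> W) h : linear f ->
  tlift (fun a b => eps a *: f b) (Delta h) = f h.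
Proof.
move=> lf; rewrite -[in RHS](counit_comull h) (linear_tlift_of _ _ lf).
by apply: eq_tlift => a b; rewrite (linearZ_of lf).
Qed.

Lemma counit_right (W : lmodType F) (f : H -> W) h : linear f ->
  tlift (fun a b => eps b *: f a) (Delta h) = f h.
Proof.
move=> lf; rewrite -[in RHS](counit_comulr h) (linear_tlift_of _ _ lf).
by apply: eq_tlift => a b; rewrite (linearZ_of lf).
Qed.

Lemma antipode1 : S 1 = 1.
Proof.
have bf : bilin (fun a b => S a * b) by split=> z k u v; lin_rw.
have := antipode_comull (1 : H); rewrite !rmorph1 scale1r.
by rewrite tlift_tensor // mulr1.
Qed.

Lemma counit_antipode h : eps (S h) = eps h.
Proof.
pose e : {linear H -> F^o} := eps.
have /(congr1 e) := antipode_comull h.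
rewrite [in RHS]linearZ linear_tlift /e /= rmorph1 [RHS]mulr1 => <-.
rewrite -[LHS](@counit_right F^o (e \o S)); last exact: linearP.
apply: (@eq_tlift F H H F^o) => a b.
by rewrite /= rmorphM; exact: mulrC.
Qed.

(** Both sides are convolution inverses of the multiplication H (x) H -> H.
    The sum of S(k_1) S(h_1) h_2 k_2 S(h_3 k_3) collapses to S(hk) when the
    first two legs of h and k are contracted, and to S(k) S(h) when the last
    two are. *)
Lemma antipodeM h k : S (h * k) = S k * S h.
Proof.
pose t a1 a2 b c d := tlift (fun c1 c2 => S c1 * S a1 * (a2 * c2) * S (b * d))
     (Delta c).
transitivity (tlift (fun a b => tlift (fun c d =>
   tlift (fun a1 a2 => t a1 a2 b c d) (Delta a)) (Delta k)) (Delta h)).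
  (* first bracketing: S(h_1) h_2 and then S(k_1) k_2 collapse *)
  rewrite -(counit_left (f := fun b => S (b * k))); last by lin.
  apply: eq_tlift => a b.
  rewrite -(counit_left (f := fun d => S (b * d))); last by lin.
  rewrite -tliftZ; apply: eq_tlift => c d.
  rewrite tlift_exchange.
  transitivity (tlift (fun c1 c2 => S c1 * (eps a *: 1) * c2 * S (b * d))
                  (Delta c)).
    transitivity ((eps c *: 1) * (eps a *: S (b * d))).
      by rewrite -scalerAl mul1r scalerA mulrC -scalerA.
    rewrite -antipode_comull -[_ * (_ *: _)]mul1r mulrA -tlift_mulLR.
    apply: eq_tlift => c1 c2.
    by rewrite mul1r -!scalerAr -!scalerAl mulr1.
  apply: eq_tlift => c1 c2.
  rewrite -antipode_comull -[_ * c2 * _]mulrA -tlift_mulLR.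
  by apply: eq_tlift => a1 a2; rewrite !mulrA.
transitivity (tlift (fun a b => tlift (fun a1 a2 =>
   tlift (fun c d => t a1 a2 b c d) (Delta k)) (Delta a)) (Delta h)).
  by apply: eq_tlift => a b; exact: tlift_exchange.
rewrite /t (sweedler_assoc (G := fun a1 a2 b =>
   tlift (fun c d => tlift (fun c1 c2 => S c1 * S a1 * (a2 * c2) * S (b * d))
     (Delta c)) (Delta k))); try by move=> *; lin.
(* second bracketing: h_2 k_2 S(h_3 k_3) is m (id (x) S) Delta at a product *)
rewrite -(counit_right (f := fun a => S k * S a)); last by lin.
apply: eq_tlift => a q.
rewrite -(counit_right (f := fun c => S c * S a)); last by lin.
rewrite -tliftZ.
transitivity (tlift (fun b1 b2 => tlift (fun c r => tlift (fun d1 d2 =>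
  S c * S a * (b1 * d1) * S (b2 * d2)) (Delta r)) (Delta k)) (Delta q)).
  apply: eq_tlift => b1 b2.
  by rewrite (sweedler_assoc (G := fun c1 c2 d =>
    S c1 * S a * (b1 * c2) * S (b2 * d))) //; try by move=> *; lin.
rewrite tlift_exchange; apply: eq_tlift => c r.
have bf : bilin (fun a b => a * S b) by split=> z u v w; lin_rw.
transitivity (S c * S a * tlift (fun a b => a * S b) (Delta (q * r)) * 1).
  rewrite rmorphM tlift_mul // -tlift_mulLR; apply: eq_tlift => b1 b2.
  by rewrite -tlift_mulLR; apply: eq_tlift => d1 d2; rewrite !mulrA mulr1.
by rewrite antipode_comulr mulr1 -scalerAr mulr1 rmorphM /= scalerA.
Qed.

(** For T = L_1 (x) S(L_2) this says h T = T h, the two actions being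
    multiplication on the left of the first leg and on the right of the second.
    Indeed h L_1 (x) S(L_2) = h_1 L_1 (x) S(L_2) S(h_2) h_3, which is
    (h_1 L)_1 (x) S((h_1 L)_2) h_2 because S is antimultiplicative, and
    h_1 L = eps(h_1) L. *)
Lemma integral_casimir (W : lmodType F) (beta : H -> H -> W) (L : H) h :
  bilin beta -> (forall x, x * L = eps x *: L) ->
  tlift (fun a b => beta (h * a) (S b)) (Delta L) =
  tlift (fun a b => beta a (S b * h)) (Delta L).
Proof.
move=> bb hL; have [bl br] := bb.
pose G x y z := tlift (fun a b => beta (x * a) (S (y * b) * z)) (Delta L).
have lG : [/\ forall y z, linear (fun x => G x y z),
   forall x z, linear (fun y => G x y z) & forall x y, linear (G x y)].
  split=> ? ?; apply: tlift_param_linear => a b k u v.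
  - by rewrite mulrDl -scalerAl bl.
  - by rewrite mulrDl -scalerAl linearP mulrDl -scalerAl br.
  - by rewrite mulrDr -scalerAr br.
have [lG1 lG2 lG3] := lG.
have := sweedler_assoc h lG1 lG2 lG3.
have -> : tlift (fun a c => tlift (fun a1 a2 => G a1 a2 c) (Delta a)) (Delta h)
   = tlift (fun a b => beta a (S b * h)) (Delta L).
  pose f z := tlift (fun a b => beta a (S b * z)) (Delta L).
  rewrite -[RHS]/(f h) -counit_left; last first.
    by apply: tlift_param_linear => a b k u v; rewrite mulrDr -scalerAr br.
  apply: eq_tlift => p z.
  have bz : bilin (fun a b => beta a (S b * z)).
    split=> [x | x] k u v; first by rewrite bl.
    by rewrite linearP mulrDl -scalerAl br.
  transitivity (tlift (fun a b => beta a (S b * z)) (Delta (p * L))).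
    by rewrite rmorphM (tlift_mul _ _ bz).
  by rewrite hL linearZ linearZ.
move=> ->; pose f x := tlift (fun a b => beta (x * a) (S b)) (Delta L).
rewrite -[LHS]/(f h) -counit_right; last first.
  by apply: tlift_param_linear => a b k u v; rewrite mulrDl -scalerAl bl.
apply: eq_tlift => x q; rewrite /f -tliftZ /G tlift_exchange.
apply: eq_tlift => a b.
transitivity (beta (x * a) (S b * (eps q *: 1))).
  by rewrite -scalerAr mulr1 (linearZ_of (br _)).
rewrite -antipode_comull -[S b * _]mulr1 -tlift_mulLR.
rewrite (linear_tlift_of _ _ (br _)); apply: eq_tlift => y z.
by rewrite antipodeM mulr1 mulrA.
Qed.

End HopfIdentities.

(** * Idempotent matrices and Kronecker products *)

Section Matrices.
Variable F : fieldType.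

Lemma mulmx_cV_inj m n (A B : 'M[F]_(m, n)) :
  (forall v : 'cV_n, A *m v = B *m v) -> A = B.
Proof.
move=> AB; apply/matrixP => i j; have := AB (delta_mx j 0).
by rewrite -!colE => /matrixP/(_ i 0); rewrite !mxE.
Qed.

Lemma lfun_mulmx m n (f : 'Hom('cV[F]_n, 'cV[F]_m)) :
  exists A, forall v, f v = A *m v.
Proof.
exists (lin1_mx (trmx \o f \o trmx))^T => v.
by rewrite -[v in RHS]trmxK -trmx_mul mul_rV_lin1 /= !trmxK.
Qed.

(** An idempotent is the inclusion of its image after the projection to it, in
    coordinates; conjugating by P and U restricts operators to that image. *)
Lemma idempotent_factor n (E : 'M[F]_n) : E *m E = E ->
  exists r (P : 'M_(n, r)) (U : 'M_(r, n)),
    [/\ r = \rank E, E = P *m U & U *m P = 1%:M].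
Proof.
move=> EE; exists (\rank E), (col_base E), (row_base E).
rewrite mulmx_base; split=> //.
move: (col_base E) (row_base E) (col_base_full E) (row_base_free E)
  (mulmx_base E) => P U Pf Uf PU.
move: (pinvmx P) (pinvmx U) (mulVpmx Pf) (mulmxVp Uf) => P' U' P'P UU'.
move: EE; rewrite -{1 2 3}PU => /(congr1 (fun M => P' *m M *m U')).
by rewrite !mulmxA P'P mul1mx -!mulmxA UU' mulmx1.
Qed.

Lemma idempotent_trace n (E : 'M[F]_n) : E *m E = E -> \tr E = (\rank E)%:R.
Proof.
case/idempotent_factor=> r [P [U [<- -> UP]]].
by rewrite mxtrace_mulC UP mxtrace1.
Qed.

Lemma tensmx_linear m n p q (W : lmodType F) (f : W -> 'M[F]_(m, n))
    (B : 'M[F]_(p, q)) : linear f -> linear (fun x => f x *t B).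
Proof.
move=> lf a x y; rewrite lf; apply/matrixP=> i j.
by rewrite !mxE mulrDl mulrA.
Qed.

Lemma tensmx_linear_r m n p q (W : lmodType F) (f : W -> 'M[F]_(p, q))
    (A : 'M[F]_(m, n)) : linear f -> linear (fun x => A *t f x).
Proof.
move=> lf a x y; rewrite lf; apply/matrixP=> i j.
by rewrite !mxE mulrDr mulrCA.
Qed.

Lemma mxtrace_tens m n (A : 'M[F]_m) (B : 'M[F]_n) :
  \tr (A *t B) = \tr A * \tr B.
Proof. by rewrite /mxtrace mulr_sum; apply: eq_bigr => i _; rewrite mxE. Qed.

(** The map A *t B^T |-> A *m B: if M acts on matrices X as a combination of
    operators X |-> A *m X *m B, this is the value of M at the identity. *)
Definition contract n (M : 'M[F]_(n * n)) : 'M[F]_n :=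
  \matrix_(i, j) \sum_k M (mxtens_index (i, j)) (mxtens_index (k, k)).

Lemma contract_linear n : linear (@contract n).
Proof.
move=> a M N; apply/matrixP=> i j; rewrite !mxE mulr_sumr -big_split.
by apply: eq_bigr => k _; rewrite !mxE.
Qed.

Lemma contract_tens n (A B : 'M[F]_n) : contract (A *t B^T) = A *m B.
Proof.
by apply/matrixP=> i j; rewrite !mxE; apply: eq_bigr => k _; rewrite tensmxE mxE.
Qed.

End Matrices.

(** * Representations on Hom spaces and averaging over an integral *)

Section Representations.
Variables (F : fieldType) (H : hopfAlgType F).
Local Notation S := (@antipode F H).
Local Notation eps := (@counit F H).
Local Notation Delta := (@comul F H).

(** The size may be zero here, as is needed for induction on dimension; an
    lrmorphism to matrices requires a nontrivial ring as its target. *)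
Definition is_rep n (rho : {linear H -> 'M[F]_n}) : Prop :=
  rho 1 = 1%:M /\ forall h k, rho (h * k) = rho h *m rho k.

Lemma lrmorphism_is_rep n (rho : {lrmorphism H -> 'M[F]_n.+1}) : is_rep rho.
Proof. by split=> [|h k]; rewrite ?rmorph1 ?rmorphM. Qed.

(** The action X |-> sum rho(h_1) X sigma(S h_2) on Hom(sigma, rho), i.e. the
    tensor product of rho with the dual of sigma, in Kronecker coordinates. *)
Definition hom_rep n m (rho : {linear H -> 'M[F]_n})
    (sigma : {linear H -> 'M[F]_m}) : {linear H -> 'M[F]_(n * m)} :=
  tlift (fun a b => rho a *t (sigma (S b))^T) \o Delta.

Section HomRep.
Variables (n m : nat) (rho : {linear H -> 'M[F]_n}).
Variables (sigma : {linear H -> 'M[F]_m}).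

Let bilin_hom : bilin (fun a b => rho a *t (sigma (S b))^T).
Proof.
split=> x; first by apply: tensmx_linear; exact: linearP.
by apply: tensmx_linear_r => a u v; rewrite !linearP.
Qed.

Lemma hom_repP : is_rep rho -> is_rep sigma -> is_rep (hom_rep rho sigma).
Proof.
move=> [r1 rM] [s1 sM]; split=> [|h k]; rewrite /hom_rep /=.
  rewrite rmorph1 -[1]/(tensor 1 1) tlift_tensor // antipode1 r1 s1 trmx1.
  apply/matrixP=> i j; case: (mxtens_indexP i) => i1 i2.
  case: (mxtens_indexP j) => j1 j2; rewrite tensmxE !mxE -natrM mulnb.
  by rewrite (can_eq (@mxtens_indexK _ _)).
rewrite rmorphM tlift_mul //.
rewrite -[RHS]/(mulmxr _ _) linear_tlift; apply: eq_tlift => a b /=.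
rewrite linear_tlift; apply: eq_tlift => c d.
by rewrite /= tensmx_mul antipodeM rM sM trmx_mul.
Qed.

Lemma hom_rep_trace h : \tr (hom_rep rho sigma h) =
  tlift (fun a b => \tr (rho a) * \tr (sigma (S b)) : F^o) (Delta h).
Proof.
pose tr : {linear 'M[F]_(n * m) -> F^o} := @mxtrace _ _.
rewrite -[LHS]/(tr _) [tr _]linear_tlift; apply: (@eq_tlift F H H F^o) => a b.
by rewrite /tr /= mxtrace_tens mxtrace_tr.
Qed.

End HomRep.

(** The identity matrix is an invariant of End(rho): it is sent to
    rho(L_1 S(L_2)) = eps(L). *)
Lemma hom_rep_neq0 n (rho : {linear H -> 'M[F]_n.+1}) L :
  is_rep rho -> eps L != 0 -> hom_rep rho rho L != 0.
Proof.
move=> [r1 rM]; apply: contra => /eqP /(congr1 (@contract F n.+1)).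
rewrite [LHS](linear_tlift_of _ _ (@contract_linear F n.+1)).
have -> : contract (0 : 'M[F]_(n.+1 * n.+1)) = 0.
  by apply/matrixP=> i j; rewrite !mxE big1 // => k _; rewrite mxE.
rewrite (@eq_tlift _ _ _ _ _ (fun a b => rho (a * S b))); last first.
  by move=> a b; rewrite contract_tens rM.
rewrite -linear_tlift antipode_comulr linearZ /= r1 => /matrixP/(_ 0 0).
by rewrite !mxE mulr1 => ->.
Qed.

Section Integral.
Variables (L : H) (hL : idempotent_integral L).

Lemma counit_integral : eps L = 1.
Proof.
case: hL => hl _ LL L0; have := hl L; rewrite LL -{1}[L]scale1r.
move/eqP; rewrite -subr_eq0 -scalerBl scaler_eq0 (negbTE L0) orbF subr_eq0.
by move/eqP.
Qed.

Lemma rep_integral_idem n (rho : {linear H -> 'M[F]_n}) : is_rep rho ->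
  rho L *m rho L = rho L.
Proof. by case: hL => _ _ LL _ [_ rM]; rewrite -rM LL. Qed.

(** The bilinear form f, g |-> f(L_1) g(S(L_2)) given by the Casimir element.
    On characters it is the dimension of the space of intertwiners. *)
Definition casimir_form (f g : H -> F) : F :=
  tlift (fun a b => f a * g (S b) : F^o) (Delta L).

(** The integral acts on Hom(sigma, rho) as an idempotent whose trace is the
    value of the form. *)
Lemma casimir_form_trace_nat n m (rho : {linear H -> 'M[F]_n})
   (sigma : {linear H -> 'M[F]_m}) : is_rep rho -> is_rep sigma ->
   casimir_form (fun h => \tr (rho h)) (fun h => \tr (sigma h)) =
    (\rank (hom_rep rho sigma L))%:R.
Proof.
move=> hr hs; rewrite -idempotent_trace ?hom_rep_trace //.
by apply: rep_integral_idem; exact: hom_repP.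
Qed.

Definition average n m (rho : {linear H -> 'M[F]_n})
   (sigma : {linear H -> 'M[F]_m}) (X : 'M[F]_(n, m)) : 'M[F]_(n, m) :=
  tlift (fun a b => rho a *m X *m sigma (S b)) (Delta L).

Lemma average_intertwines n m (rho : {linear H -> 'M[F]_n})
    (sigma : {linear H -> 'M[F]_m}) X h : is_rep rho -> is_rep sigma ->
  rho h *m average rho sigma X = average rho sigma X *m sigma h.
Proof.
move=> [_ rM] [_ sM]; have [hl _ _ _] := hL.
rewrite /average (linear_tlift_of (g := mulmx (rho h))); last exact: linearP.
rewrite -[RHS]/(mulmxr (sigma h) _).
rewrite (linear_tlift_of (g := mulmxr (sigma h))) /=; last exact: linearP.
have bb : bilin (fun a b => rho a *m X *m sigma b).
  split=> x a u v; first by rewrite linearP !mulmxDl -!scalemxAl.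
  by rewrite linearP mulmxDr -scalemxAr.
have := integral_casimir h bb hl => E.
transitivity (tlift (fun a b => rho (h * a) *m X *m sigma (S b)) (Delta L)).
  by apply: eq_tlift => a b; rewrite rM !mulmxA.
by rewrite E; apply: eq_tlift => a b; rewrite sM !mulmxA.
Qed.

Lemma average_linear n m (rho : {linear H -> 'M[F]_n})
    (sigma : {linear H -> 'M[F]_m}) : linear (average rho sigma).
Proof.
apply: tlift_param_linear => a b c u v.
by rewrite mulmxDr mulmxDl -scalemxAr -scalemxAl.
Qed.

Lemma average1 n (rho : {linear H -> 'M[F]_n}) : is_rep rho ->
  average rho rho 1%:M = 1%:M.
Proof.
move=> [r1 rM]; rewrite /average.
rewrite (@eq_tlift _ _ _ _ _ (fun a b => rho (a * S b))); last first.
  by move=> a b; rewrite mulmx1 rM.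
by rewrite -linear_tlift antipode_comulr counit_integral scale1r r1.
Qed.

(** The right-hand side is the trace of averaging as an operator on matrices;
    the trace of X |-> A *m X *m B is the product of the traces of A and B. *)
Lemma casimir_form_average n m (rho : {linear H -> 'M[F]_n})
   (sigma : {linear H -> 'M[F]_m}) :
   casimir_form (fun h => \tr (rho h)) (fun h => \tr (sigma h)) =
   \sum_k \sum_l average rho sigma (delta_mx k l) k l.
Proof.
transitivity (\sum_k \sum_l tlift (fun a b =>
    (rho a *m delta_mx k l *m sigma (S b)) k l : F^o) (Delta L)); last first.
  apply: eq_bigr => k _; apply: eq_bigr => l _.
  rewrite /average (linear_tlift_of (X := F^o) (W := 'M[F]_(n, m))
    (g := fun M => M k l)) //.
  by move=> a u v; rewrite !mxE.
transitivity (tlift (fun a b => \sum_k \sum_l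
    (rho a *m delta_mx k l *m sigma (S b)) k l : F^o) (Delta L)).
  apply: (@eq_tlift F H H F^o) => a b.
  rewrite /mxtrace mulr_suml; apply: eq_bigr => k _.
  rewrite mulr_sumr; apply: eq_bigr => l _.
  rewrite mxE (bigD1 l) //= mxE (bigD1 k) //= !mxE !eqxx mulr1.
  rewrite !big1 ?addr0 // => i ni; last first.
    by rewrite mxE (negbTE ni) mulr0.
  rewrite mxE big1 ?mul0r // => j _.
  by rewrite mxE (negbTE ni) andbF mulr0.
rewrite tlift_sum; apply: eq_bigr => k _.
by rewrite tlift_sum.
Qed.

End Integral.
End Representations.

(** * Schur's lemma and orthogonality of characters *)

Section Schur.
Variables (F : fieldType) (H : hopfAlgType F).

Lemma schur_inverse n m (rho : {lrmorphism H -> 'M[F]_n.+1})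
    (sigma : {lrmorphism H -> 'M[F]_m.+1}) (X : 'M[F]_(n.+1, m.+1)) :
  irreducible_rep rho -> irreducible_rep sigma ->
  (forall h, rho h *m X = X *m sigma h) -> X != 0 ->
  exists Y, X *m Y = 1%:M /\ Y *m X = 1%:M.
Proof.
move=> irr_rho irr_sigma XI X0.
pose f : 'Hom('cV[F]_m.+1, 'cV[F]_n.+1) := linfun (mulmx X).
have fE v : f v = X *m v by rewrite lfunE.
have fN0 : ~ (forall v, f v = 0).
  move=> f0; case/eqP: X0; apply: mulmx_cV_inj => v.
  by rewrite -fE f0 mul0mx.
have ker0 : lker f == 0%VS.
  case: (irr_sigma (lker f)) => [h v|->//|kf].
    rewrite !memv_ker !fE => /eqP Xv.
    by rewrite mulmxA -XI -mulmxA Xv mulmx0.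
  by case: fN0 => v; apply/eqP; rewrite -memv_ker kf memvf.
have imf : limg f = fullv.
  case: (irr_rho (limg f)) => [h _ /memv_imgP[v _ ->]|im0|//].
    by rewrite fE mulmxA XI -mulmxA -fE memv_img ?memvf.
  case: fN0 => v; apply/eqP; rewrite -memv0 -im0.
  by rewrite memv_img ?memvf.
have [Y YE] := lfun_mulmx (f^-1)%VF.
exists Y; split; apply: mulmx_cV_inj => v; rewrite mul1mx -mulmxA.
  by rewrite -YE -fE limg_lfunVK // imf memvf.
by rewrite -fE -YE lker0_lfunK.
Qed.

End Schur.

Section SchurScalar.
Variables (F : closedFieldType) (H : hopfAlgType F).

Lemma schur_scalar n (rho : {lrmorphism H -> 'M[F]_n.+1}) X :
  irreducible_rep rho -> (forall h, rho h *m X = X *m rho h) ->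
  exists c, X = c%:M.
Proof.
move=> irr XI.
have /closed_rootP[c] : size (char_poly X) != 1%N by rewrite size_char_poly.
rewrite -eigenvalue_root_char => /eigenvalueP[v vX v0]; exists c.
apply/eqP; rewrite -subr_eq0; apply: contraNT v0 => XcN0.
have [h|Y [XY _]] := schur_inverse irr irr _ XcN0.
  by rewrite mulmxBr mulmxBl XI scalar_mxC.
by rewrite -[v]mulmx1 -XY mulmxA mulmxBr vX mul_mx_scalar subrr mul0mx.
Qed.

Variables (L : H) (hL : idempotent_integral L).

(** The form is the trace of averaging X |-> sum rho(L_1) X sigma(S L_2), whose
    values are intertwiners. They vanish for distinct characters. For f = g they
    are scalars, so that the trace only sees diagonal matrix units, which sum up
    to the identity, a fixed point of averaging. *)
Lemma irreducible_character_orthogonality (f g : dual H) :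
  irreducible_character f -> irreducible_character g ->
  casimir_form L f g = (f == g)%:R.
Proof.
move=> [n [rho [irr_rho fE]]] [m [sigma [irr_sigma gE]]].
have hr := lrmorphism_is_rep rho; have hs := lrmorphism_is_rep sigma.
case: eqP => [<-|fg].
  transitivity (casimir_form L (fun h => \tr (rho h)) (fun h => \tr (rho h))).
    by apply: (@eq_tlift F H H F^o) => a b; rewrite !fE.
  rewrite casimir_form_average.
  have scal X : exists c, average L rho rho X = c%:M.
    apply: schur_scalar irr_rho _ => h.
    by have := average_intertwines hL X h hr hr.
  transitivity (\sum_k average L rho rho (delta_mx k k) 0 0).
    apply: eq_bigr => k _; rewrite (bigD1 k) //= big1 ?addr0 => [|l lk].
      by have [c ->] := scal (delta_mx k k); rewrite !mxE !eqxx.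
    by have [c ->] := scal (delta_mx k l); rewrite !mxE eq_sym (negbTE lk).
  transitivity (average L rho rho 1%:M 0 0); last first.
    by rewrite (average1 hL hr) mxE eqxx.
  rewrite -summxE; congr (fun_of_matrix _ 0 0).
  pose av : {linear 'M[F]_n.+1 -> 'M[F]_n.+1} := HB.pack (average L rho rho)
    (GRing.isLinear.Build _ _ _ _ (average L rho rho) (average_linear L rho rho)).
  rewrite -[LHS]/(\sum_k av (delta_mx k k)) -linear_sum.
  congr average; apply/matrixP => i j; rewrite summxE (bigD1 i) //= !mxE eqxx.
  rewrite big1 => [|k ki]; last by rewrite mxE eq_sym (negbTE ki).
  by rewrite addr0 eq_sym.
transitivity (casimir_form L (fun h => \tr (rho h)) (fun h => \tr (sigma h))).
  by apply: (@eq_tlift F H H F^o) => a b; rewrite fE gE.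
rewrite casimir_form_average big1 // => k _; rewrite big1 // => l _.
have XI h := average_intertwines hL (delta_mx k l) h hr hs.
have [->|XN0] := eqVneq (average L rho sigma (delta_mx k l)) 0.
  by rewrite mxE.
have [Y [XY YX]] := schur_inverse irr_rho irr_sigma XI XN0.
case: fg; apply/lfunP => h; rewrite fE gE.
by rewrite -[rho h]mulmx1 -XY mulmxA XI mxtrace_mulC mulmxA YX mul1mx.
Qed.

End SchurScalar.

(** * Characters as combinations of irreducible characters *)

Section Decomposition.
Variables (F : fieldType) (H : hopfAlgType F).
Variables (n : nat) (chi : 'I_n.+1 -> dual H) (hchi : irr_enum chi).

(** Existence of a composition series, on the level of traces: by induction on
    the dimension, a proper invariant subspace, given as the image of an
    idempotent E, splits the trace into those of the subrepresentation on the
    image of E and of the quotient, realised on the image of 1 - E. *)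
Lemma rep_trace_decomp m (rho : {linear H -> 'M[F]_m}) : is_rep rho ->
  exists c : 'I_n.+1 -> F, forall h, \tr (rho h) = \sum_j c j * chi j h.
Proof.
elim/ltn_ind: m rho => -[_ rho _ | m IH rho [r1 rM]].
  exists (fun=> 0) => h; rewrite /mxtrace big_ord0 big1 // => j _.
  by rewrite mul0r.
have [irr|] := EM (forall W : {vspace 'cV[F]_m.+1},
    (forall h w, w \in W -> rho h *m w \in W) -> W = 0%VS \/ W = fullv).
  pose rho' : {lrmorphism H -> 'M[F]_m.+1} := HB.pack (rho : H -> 'M[F]_m.+1)
    (GRing.Linear.on (rho : H -> 'M[F]_m.+1))
    (GRing.isMonoidMorphism.Build H 'M[F]_m.+1 rho (r1, rM)).
  pose tr : {linear 'M[F]_m.+1 -> F^o} := @mxtrace _ _.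
  pose f : dual H := linfun (tr \o rho).
  have fE h : f h = \tr (rho h) by rewrite lfunE.
  have [_ chiP _] := hchi; have [|i iE] := (chiP f).1; first by exists m, rho'.
  exists (fun j => (j == i)%:R) => h; rewrite -fE -iE (bigD1 i) //= eqxx mul1r.
  by rewrite big1 ?addr0 // => j /negbTE->; rewrite mul0r.
move=> /existsNP[W] /not_implyP[Winv] /not_orP[W0 Wfull].
have [E EE] := lfun_mulmx (projv W).
have Eidem : E *m E = E.
  by apply: mulmx_cV_inj => v; rewrite -mulmxA -!EE projv_proj.
have Einv h : E *m rho h *m E = rho h *m E.
  apply: mulmx_cV_inj => v; rewrite -!mulmxA -!EE projv_id // EE.
  by apply: Winv; rewrite -EE memv_proj.
have E'idem : (1%:M - E) *m (1%:M - E) = 1%:M - E.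
  by rewrite mulmxBr mulmx1 mulmxBl mul1mx Eidem subrr subr0.
have [r [P [U [rE EPU UP]]]] := idempotent_factor Eidem.
have [s [Q [V [sE EQV VQ]]]] := idempotent_factor E'idem.
have VE : V *m E = 0.
  rewrite -[V]mul1mx -VQ -[V *m Q *m V]mulmxA -EQV -mulmxA mulmxBl mul1mx Eidem.
  by rewrite subrr mulmx0.
have rkE : (r < m.+1)%N.
  rewrite rE.
  rewrite ltn_neqAle rank_leq_row andbT; apply: contra_notN Wfull => rkE.
  have uE : E \in unitmx by rewrite -row_free_unit.
  have E1 : E = 1%:M by rewrite -[LHS](mulKmx uE) Eidem mulVmx.
  apply/eqP; rewrite eqEsubv subvf /=; apply/subvP => v _.
  by rewrite -[v]mul1mx -E1 -EE memv_proj.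
have rkE' : (s < m.+1)%N.
  rewrite sE.
  rewrite ltn_neqAle rank_leq_row andbT; apply: contra_notN W0 => rkE'.
  have uE : 1%:M - E \in unitmx by rewrite -row_free_unit.
  have E0 : E = 0.
    have : 1%:M - E = 1%:M by rewrite -[LHS](mulKmx uE) E'idem mulVmx.
    by move/eqP; rewrite subr_eq addrC -subr_eq subrr eq_sym => /eqP.
  apply/eqP; rewrite -subv0; apply/subvP => v vW.
  by rewrite -(projv_id vW) EE E0 mul0mx mem0v.
pose rU : {linear H -> 'M[F]_r} := mulmxr P \o mulmx U \o rho.
pose rV : {linear H -> 'M[F]_s} := mulmxr Q \o mulmx V \o rho.
have EP h : E *m (rho h *m P) = rho h *m P.
  have -> : P = E *m P by rewrite EPU -mulmxA UP mulmx1.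
  by rewrite !mulmxA Einv.
have VrE h : V *m rho h *m E = 0 by rewrite -mulmxA -Einv !mulmxA VE !mul0mx.
have [|c cE] := IH _ rkE rU.
  split=> [|h k]; rewrite /rU /= ?r1 ?mulmx1 // rM.
  by rewrite -!mulmxA (mulmxA P) -EPU EP.
have [|d dE] := IH _ rkE' rV.
  split=> [|h k]; rewrite /rV /= ?r1 ?mulmx1 // rM.
  rewrite !mulmxA -[in RHS](mulmxA _ Q) -EQV mulmxBr mulmx1.
  by rewrite VrE subr0.
exists (fun j => c j + d j) => h.
under eq_bigr do rewrite mulrDl.
rewrite big_split /= -cE -dE /rU /rV /= ![\tr (_ *m _ *m _)]mxtrace_mulC.
by rewrite !mulmxA -EPU -EQV -mxtraceD -mulmxDl addrC subrK mul1mx.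
Qed.

End Decomposition.

(** * The regular character *)

Section RegularRepresentation.
Variables (F : fieldType) (H : hopfAlgType F).

Definition regular_mx (h : H) : 'M[F]_(\dim {:H}) :=
  \matrix_(i, j) coord (vbasis {:H}) i (h * (vbasis {:H})`_j).

Fact regular_mx_linear : linear regular_mx.
Proof.
by move=> a h k; apply/matrixP=> i j; rewrite !mxE mulrDl -scalerAl linearP.
Qed.

HB.instance Definition _ :=
  GRing.isLinear.Build F H 'M[F]_(\dim {:H}) *:%R regular_mx regular_mx_linear.

Lemma regular_mxP : is_rep regular_mx.
Proof.
have free_b := basis_free (vbasisP {:H}).
split=> [|h k]; apply/matrixP => i j; rewrite !mxE.
  by rewrite mul1r coord_free // eq_sym.
rewrite -mulrA {1}[k * _](coord_vbasis (memvf _)) mulr_sumr linear_sum.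
by apply: eq_bigr => l _; rewrite -scalerAr linearZ !mxE mulrC.
Qed.

(** Writing the regular character as a sum of b_k^*(x b_k) over a basis, the
    Casimir identity moves b_k from the second leg of L_1 (x) S(L_2) to the
    first, where the sum over k yields f(S(L_2) L_1) = f(L_1 S(L_2)). *)
Lemma casimir_form_regular (L : H) (f : {linear H -> F^o}) :
  idempotent_integral L -> (forall h k, f (h * k) = f (k * h)) ->
  casimir_form L f (fun h => \tr (regular_mx h)) = f 1.
Proof.
move=> hL fC; have [hl _ _ _] := hL.
transitivity (\sum_(k < \dim {:H}) tlift (fun a b : H => f a *
   coord (vbasis {:H}) k (antipode b * (vbasis {:H})`_k) : F^o) (comul L)).
  rewrite -tlift_sum; apply: (@eq_tlift F H H F^o) => a b.
  by rewrite /mxtrace mulr_sumr; apply: eq_bigr => k _; rewrite mxE.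
transitivity (\sum_(k < \dim {:H}) tlift (fun a b : H =>
   f ((vbasis {:H})`_k * a) * coord (vbasis {:H}) k (antipode b) : F^o) (comul L)).
  apply: eq_bigr => k _.
  have bb : @bilin F H H F^o (fun a b => f a * coord (vbasis {:H}) k b).
    split=> x a u v; first by rewrite linearP /= mulrDl -scalerAl.
    by rewrite linearP /= mulrDr -scalerAr.
  by rewrite -(integral_casimir _ bb hl).
rewrite -tlift_sum -[RHS]scale1r -(counit_integral hL) -linearZ.
rewrite -antipode_comulr linear_tlift; apply: (@eq_tlift F H H F^o) => a b.
rewrite [RHS]fC {2}[antipode b](coord_vbasis (memvf _)) mulr_suml linear_sum.
by apply: eq_bigr => k _; rewrite -scalerAl linearZ; exact: mulrC.
Qed.

End RegularRepresentation.

(** * The commutator matrix *)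

Section CommutatorMatrix.
Variables (C : numClosedFieldType) (H : hopfAlgType C).
Variables (L : H) (hL : idempotent_integral L).
Variables (n : nat) (chi : 'I_n.+1 -> dual H) (hchi : irr_enum chi).

Lemma irr_enum_rep i : exists m (rho : {lrmorphism H -> 'M[C]_m.+1}),
  irreducible_rep rho /\ forall h, chi i h = \tr (rho h).
Proof. by have [_ chiP _] := hchi; apply: (chiP _).2; exists i. Qed.

(** By orthogonality, the coefficient of chi i is the value of the Casimir form
    at chi i and the regular character. *)
Lemma regular_character_sum h :
  \tr (regular_mx h) = \sum_j chi j 1 * chi j h.
Proof.
have [c cE] := rep_trace_decomp hchi (@regular_mxP C H).
rewrite cE; apply: eq_bigr => i _; congr (_ * _).
have [m [rho [irr chiE]]] := irr_enum_rep i.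
have chiC x y : chi i (x * y) = chi i (y * x).
  by rewrite !chiE !rmorphM mxtrace_mulC.
rewrite -(casimir_form_regular hL chiC).
transitivity (\sum_j tlift (fun a b =>
   c j *: (chi i a * chi j (antipode b)) : C^o) (comul L)); last first.
  rewrite -tlift_sum; apply: (@eq_tlift C H H C^o) => a b.
  by rewrite cE mulr_sumr; apply: eq_bigr => j _; exact: mulrCA.
have [inj_chi chiP _] := hchi.
have orth j : casimir_form L (chi i) (chi j) = (i == j)%:R.
  rewrite -(inj_eq inj_chi);
  apply: irreducible_character_orthogonality => //; apply: (chiP _).2.
    by exists i.
  by exists j.
under eq_bigr => j _ do rewrite tliftZ [tlift _ _]orth.
rewrite (bigD1 i) //= eqxx big1 ?addr0 => [|j ji].
  by rewrite [RHS]mulr1.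
by rewrite eq_sym (negbTE ji) scaler0.
Qed.

Lemma irr_degree_gt0 i : 0 < chi i 1.
Proof.
have [m [rho [_ ->]]] := irr_enum_rep i.
by rewrite rmorph1 mxtrace1 ltr0n.
Qed.

(** The numerator is the multiplicity of chi j in chi i * s(chi i), that is, in
    the character of End(V_i). *)
Lemma commutator_mxE i j : commutator_mx chi L i j =
  casimir_form L (conv (chi i) (dual_antipode (chi i))) (chi j) / chi j 1.
Proof.
rewrite mxE convE; congr (_ / _); apply: (@eq_tlift C H H C^o) => a b.
by rewrite dual_antipodeE.
Qed.

Lemma conv_dual_antipode_trace (f : dual H) m (rho : {linear H -> 'M[C]_m}) h :
  (forall x, f x = \tr (rho x)) ->
  conv f (dual_antipode f) h = \tr (hom_rep rho rho h).
Proof.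
move=> fE; rewrite convE hom_rep_trace; apply: (@eq_tlift C H H C^o) => a b.
by rewrite dual_antipodeE !fE.
Qed.

Lemma casimir_form_conv_nat i j : exists k : nat,
  casimir_form L (conv (chi i) (dual_antipode (chi i))) (chi j) = k%:R.
Proof.
have [m [rho [_ rhoE]]] := irr_enum_rep i.
have [p [sigma [_ sigmaE]]] := irr_enum_rep j.
have hr := lrmorphism_is_rep rho; have hs := lrmorphism_is_rep sigma.
have := casimir_form_trace_nat hL (hom_repP hr hr) hs; move: (\rank _) => k kE.
exists k; rewrite -kE; apply: (@eq_tlift C H H C^o) => a b.
by rewrite (conv_dual_antipode_trace _ rhoE) sigmaE.
Qed.

(** Every End(V_i) contains the trivial representation, spanned by the
    identity. *)
Lemma casimir_form_conv_trivial_gt0 i :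
  0 < casimir_form L (conv (chi i) (dual_antipode (chi i))) (chi 0).
Proof.
have [m [rho [_ rhoE]]] := irr_enum_rep i.
have hr := lrmorphism_is_rep rho; have [_ _ chi0] := hchi.
have -> : casimir_form L (conv (chi i) (dual_antipode (chi i))) (chi 0) =
    \tr (hom_rep rho rho L).
  pose g : {linear H -> C^o} := conv (chi i) (dual_antipode (chi i)).
  rewrite -(conv_dual_antipode_trace _ rhoE) -[RHS]/(g L).
  rewrite -[RHS]counit_right; last exact: linearP.
  apply: (@eq_tlift C H H C^o) => a b.
  by rewrite chi0 counit_antipode; exact: mulrC.
rewrite idempotent_trace; last exact: (rep_integral_idem hL (hom_repP hr hr)).
rewrite ltr0n lt0n mxrank_eq0; apply: hom_rep_neq0 => //.
by rewrite (counit_integral hL) oner_neq0.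
Qed.

(** The dimension of End(V_i), counted by multiplicities: pair its character
    with the regular one. *)
Lemma casimir_form_conv_degree_sum i :
  \sum_j casimir_form L (conv (chi i) (dual_antipode (chi i))) (chi j) * chi j 1
  = chi i 1 ^+ 2.
Proof.
have [m [rho [_ rhoE]]] := irr_enum_rep i.
have hr := lrmorphism_is_rep rho; have [_ tM] := hom_repP hr hr.
set f := conv _ _; have fE x : f x = \tr (hom_rep rho rho x).
  exact: conv_dual_antipode_trace.
have fC x y : f (x * y) = f (y * x) by rewrite !fE !tM mxtrace_mulC.
have -> : chi i 1 ^+ 2 = f 1.
  rewrite fE (hom_repP hr hr).1 rhoE rmorph1 !mxtrace1.
  by rewrite natrM expr2.
rewrite -(casimir_form_regular hL fC).
transitivity (\sum_j tlift (fun a b =>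
   chi j 1 *: (f a * chi j (antipode b)) : C^o) (comul L)).
  by apply: eq_bigr => j _; rewrite tliftZ; exact: mulrC.
rewrite -tlift_sum; apply: (@eq_tlift C H H C^o) => a b.
by rewrite regular_character_sum mulr_sumr; apply: eq_bigr => j _; exact: mulrCA.
Qed.

Lemma commutator_mx_spectrum (A := commutator_mx chi L) :
  [/\ eigenvalue A^T 1, \rank (eigenspace A^T 1) = 1%N
    & forall c, eigenvalue A^T c -> c != 1 -> `|c| < 1].
Proof.
have dgt0 := irr_degree_gt0; have [_ _ chi0] := hchi.
apply: (@absorbing_spectrum _ _ A (\row_j chi j 1 ^+ 2)).
- by move=> i; rewrite mxE exprn_gt0.
- move=> i j; rewrite commutator_mxE; have [k ->] := casimir_form_conv_nat i j.
  by rewrite divr_ge0 ?ler0n // ltW.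
- apply/rowP => i; rewrite !mxE -casimir_form_conv_degree_sum.
  apply: eq_bigr => j _; rewrite mxE mxE commutator_mxE mulrC.
  by rewrite expr2 mulrA divfK // gt_eqF.
- by move=> i; rewrite commutator_mxE divr_gt0 // casimir_form_conv_trivial_gt0.
(* In row 0 the multiplicities times degrees are nonnegative with sum 1, and
   the term at 0 is a positive integer, so that no other term survives. *)
move=> j j0; rewrite commutator_mxE.
have := casimir_form_conv_degree_sum 0; rewrite [chi 0 1]chi0 rmorph1 expr1n.
have := casimir_form_conv_trivial_gt0 0.
rewrite (bigD1 0) //= (bigD1 j) //=; set rest := \sum_(_ | _) _.
have restge : 0 <= rest.
  apply: sumr_ge0 => k _; have [p ->] := casimir_form_conv_nat 0 k.
  by rewrite mulr_ge0 ?ler0n // ltW.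
rewrite chi0 rmorph1 mulr1.
have [p ->] := casimir_form_conv_nat 0 0; rewrite ltr0n => p_gt0.
have [q ->] := casimir_form_conv_nat 0 j => sumE.
suff : q%:R * chi j 1 <= 0.
  by rewrite pmulr_lle0 // lern0 => /eqP->; rewrite mul0r.
rewrite -(lerD2l p%:R) addr0; apply: (@le_trans _ _ 1); last by rewrite ler1n.
by rewrite -[leRHS]sumE lerD2l lerDl.
Qed.

End CommutatorMatrix.

Theorem theorem3p10 (R : realType) (H : hopfAlgType R[i])
    (hss : semisimple H)
    (Rm : tens H H) (hR : quasitriangular Rm)
    (L : H) (hL : idempotent_integral L)
    (n : nat) (chi : 'I_n.+1 -> dual H) (hchi : irr_enum chi)
    (A := commutator_mx chi L) :
  [/\ (* A^T: mathcomp's eigenspaces consist of row vectors *)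
      eigenvalue A^T 1,
      \rank (eigenspace A^T 1) = 1%N
    & forall c : R[i], eigenvalue A^T c -> c != 1 -> `|c| < 1].
Proof. exact: commutator_mx_spectrum. Qed.
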